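(* Let $s\ge 1$ be an integer, $C>1$ and $$\delta<\frac{(C-1)^2}{4C}.$$ For each sufficiently large integer $N$ let $S\subset G=\mathbb{Z}/N\mathbb{Z}$ be a fixed set with $|S|=s$, and let $\Omega$ be chosen uniformly at random among the subsets of $\hat G=\mathbb{Z}/N\mathbb{Z}$ of cardinality $$|\Omega|=\lceil(3s+2)\,C\log N\rceil .$$ Then the probability that all functions $x:G\to\mathbb{C}$ carried by $S$ have property (i) is $1-O(N^{-\delta})$ as $N\to\infty$, i.e. there is a constant $A$ (depending only on $s,C,\delta$) such that this probability is at least $1-AN^{-\delta}$ for all sufficiently large $N$. Here $x$ has property (i) (relative to $\Omega$) if for every $y:G\to\mathbb{C}$ with $y\neq x$ and $\hat y|_\Omega=\hat x|_\Omega$ one has $\|y\|_1>\|x\|_1$.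
   Context: For $x:G\to\mathbb{C}$: $\|x\|_1=\sum_{t\in G}|x(t)|$ and $\hat x(\omega)=\frac1{\sqrt N}\sum_{t\in G}x(t)\exp(-2\pi i t\omega/N)$ for $\omega\in\hat G=\mathbb{Z}/N\mathbb{Z}$. A function $x$ is carried by $S$ if $x(t)=0$ for all $t\in G\setminus S$. Property (i) says that $\hat x$ is the unique extension of $\hat x|_\Omega$ of minimal norm in the Wiener algebra of $\hat G$, where $\|\hat x\|_A=\|x\|_1$; it allows $x$ to be reconstructed from $\hat x|_\Omega$. $\log$ is the natural logarithm; $N$ is large enough that $|\Omega|<N$. *)

(* Defs.v *)
From mathcomp Require Import all_boot all_order all_algebra.
From mathcomp Require Import complex.
From mathcomp Require Import boolp reals exp trigo.

Set Implicit Arguments.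
Unset Strict Implicit.
Unset Printing Implicit Defensive.

Import Order.TTheory GRing.Theory Num.Theory.

Local Open Scope ring_scope.
Local Open Scope complex_scope.

(* Both G and its dual are represented by 'Z_N, which is Z/NZ only for N > 1;
   the definitions below are meant for such N. *)

Definition expi (R : realType) (theta : R) : R[i] := cos theta +i* sin theta.

(* t and w enter through their representatives in [0, N); the exponential
   depends only on t * w modulo N. *)
Definition fourier (R : realType) (N : nat) (x : {ffun 'Z_N -> R[i]})
    (w : 'Z_N) : R[i] :=
  ((Num.sqrt N%:R)^-1)%:C *
  \sum_(t : 'Z_N) x t * expi (- (2 * pi * (t * w)%N%:R / N%:R)).

Definition l1norm (R : realType) (N : nat) (x : {ffun 'Z_N -> R[i]}) : R :=
  \sum_(t : 'Z_N) Normc.normc (x t).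

Definition carried_by (R : realType) (N : nat) (S : {set 'Z_N})
    (x : {ffun 'Z_N -> R[i]}) : Prop :=
  forall t : 'Z_N, t \notin S -> x t = 0.

(* The Wiener norm of fourier x is l1norm x, so this says that fourier x is the
   unique minimal-norm extension of its own restriction to Om. *)
Definition property_i (R : realType) (N : nat) (Om : {set 'Z_N})
    (x : {ffun 'Z_N -> R[i]}) : Prop :=
  forall y : {ffun 'Z_N -> R[i]}, y <> x ->
    (forall w : 'Z_N, w \in Om -> fourier y w = fourier x w) ->
    l1norm x < l1norm y.

(* The value is 0 when m > #|T|, since then the denominator is 0. *)
Definition unif_subset_prob (R : realType) (T : finType) (m : nat)
    (P : {set T} -> Prop) : R :=
  #|[set Om : {set T} | (#|Om| == m) && `[< P Om >]]|%:R /
  #|[set Om : {set T} | #|Om| == m]|%:R.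

(* `|_| only casts the ceiling to nat: it is nonnegative as soon as N >= 1 and
   C >= 0. *)
Definition sample_size (R : realType) (s : nat) (C : R) (N : nat) : nat :=
  `|Num.ceil ((3 * s + 2)%N%:R * C * ln (N%:R : R))|%N.

(* Main.v *)
(* For g(w) = sum_j b_j chi((u_j - t) w), with S = {u_j} and t outside S, call
   defect the quantity Re g - |g|^2.  Property (i) holds for all x carried by S
   as soon as the sum of the defects over Omega is negative for every t outside
   S and every coefficient vector b with sum_j |b_j|^2 = 1/s: if z has Fourier
   transform vanishing on Omega, apply this with b proportional to the conjugate
   of z|_S to get the null space property sum_S |z| < sum_{S^c} |z|.

   For fixed t and b the failure probability is bounded by Chernoff's method.
   Up to a factor 2, Omega is an i.i.d. sample, and a second order expansion of
   the exponential reduces the Laplace transform to the moments of Re g and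
   |g|^2.  If t satisfies no relation u_i + u_j = 2t or u_i + u_j = t + u_k, then
   the mean of (Re g)^2 is 1/(2s) and that of Re g |g|^2 is 0, which gives a rate
   1/(3s) per sample.  The at most 2s^2 + s^3 remaining t have the worse rate
   1/(8s), but need no union over N points.  The vectors b are handled by a
   finite net depending only on s; since 1/(3s) > 1/(3s+2), its mesh is absorbed
   in the rates, and the total failure probability is O(N^(1-C) + N^(-C/4)). *)

Require Import Defs.
From mathcomp Require Import all_boot all_order all_algebra.
From mathcomp Require Import complex.
From mathcomp Require Import boolp reals sequences exp trigo.
From mathcomp Require Import ring lra zify.

Set Implicit Arguments.
Unset Strict Implicit.
Unset Printing Implicit Defensive.

Import Order.TTheory GRing.Theory Num.Theory.

Local Open Scope ring_scope.
Local Open Scope complex_scope.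

Import Normc.

(* Num.Theory shadows the projections of the complex record. *)
Local Notation Re := (@complex.Re _).
Local Notation Im := (@complex.Im _).

(** * Exponential bounds *)

Section ExponentialBounds.
Variable R : realType.
Implicit Types u w v c : R.

Lemma expR_ge_quadratic u : 0 <= u -> 1 + u + u ^+ 2 / 2 <= expR u.
Proof.
move=> u0; have -> : 1 + u + u ^+ 2 / 2 = series (exp_coeff u) 3.
  rewrite /series /= !big_nat_recr//= big_geq// /exp_coeff /= !factS fact0.
  by rewrite expr0 expr1 add0r !divr1.
apply: nondecreasing_cvgn_le; last exact: is_cvg_series_exp_coeff.
apply: nondecreasing_series => n _ _.
by rewrite /exp_coeff /= divr_ge0// exprn_ge0.
Qed.

(** Invert the lower bound at [-u]: [(1 - u + u^2/2)(1 + u + u^2/2) = 1 + u^4/4 >= 1]. *)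
Lemma expR_le_quadratic_neg u : u <= 0 -> expR u <= 1 + u + u ^+ 2 / 2.
Proof.
move=> u0; have vP : 0 <= - u by lra.
have := expR_ge_quadratic vP; rewrite expRN => h.
have e0 := expR_gt0 u.
have : (1 - u + u ^+ 2 / 2) * expR u <= 1.
  by rewrite -ler_pdivlMr// div1r; move: h; rewrite sqrrN.
have p1 : 0 < 1 - u + u ^+ 2 / 2 by have := sqr_ge0 u; lra.
move=> h1; rewrite -(ler_pM2l p1); apply: (le_trans h1).
have : 0 <= u ^+ 4 by rewrite -[4%N]/(2 * 2)%N exprM sqr_ge0.
nra.
Qed.

Lemma expR_le_quadratic_pos u : 0 <= u <= 1 / 6 -> expR u <= 1 + u + u ^+ 2.
Proof.
move=> /andP[u0 u1].
have hE : expR u * expR (- (u / 2)) ^+ 2 = 1.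
  by rewrite -expRM_natl -expRD -[RHS]expR0; congr expR; field.
have h := expR_ge1Dx (- (u / 2)).
have h2 : (1 - u / 2) ^+ 2 <= expR (- (u / 2)) ^+ 2.
  by rewrite ler_sqr ?nnegrE ?expR_ge0//; lra.
have e0 := expR_gt0 u.
have h3 : expR u * (1 - u / 2) ^+ 2 <= 1 by rewrite -[leRHS]hE ler_pM2l.
have p0 : 0 < 1 - u / 2 by lra.
have p1 : 0 < (1 - u / 2) ^+ 2 by exact: exprn_gt0.
rewrite -(ler_pM2r p1); apply: (le_trans h3).
(* A quarter of this quantity is [(1 + u + u^2)(1 - u/2)^2 - 1]. *)
have : 0 <= u ^+ 2 * (1 - 3 * u + u ^+ 2).
  by apply: mulr_ge0; [exact: sqr_ge0|have := sqr_ge0 u; lra].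
nra.
Qed.

(** Meant for [w = Re g] and [v = |g|^2]: bounding [v^2] by [v] leaves only the sums of [Re g],
    [|g|^2], [(Re g)^2] and [Re g |g|^2] to be computed. *)
Lemma expR_le_second_order c w v : 0 <= c <= 2 / 3 -> w ^+ 2 <= v <= 1 ->
  expR (c * (w - v)) <=
  1 + c * (w - v) + c ^+ 2 / 2 * (w ^+ 2 - 2 * (w * v) + v).
Proof.
move=> /andP[c0 c1] /andP[wv v1].
have v0 : 0 <= v by apply: le_trans wv; exact: sqr_ge0.
have c20 := sqr_ge0 c.
have [h|/ltW h] := leP (w - v) 0.
  have u0 : c * (w - v) <= 0 by nra.
  apply: (le_trans (expR_le_quadratic_neg u0)).
  have : 0 <= c ^+ 2 * (v - v ^+ 2) by apply: mulr_ge0 => //; nra.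
  nra.
(* Here [w - v <= w - w^2 <= 1/4], so [c <= 2/3] puts the exponent in [[0, 1/6]]. *)
have h4 : w - v <= 1 / 4 by have := sqr_ge0 (w - 1 / 2); nra.
have u0 : 0 <= c * (w - v) <= 1 / 6 by apply/andP; split; nra.
apply: (le_trans (expR_le_quadratic_pos u0)).
(* This pays for the missing factor 1/2: [w^2 - 2wv + v = (w - v)^2 + (v - v^2) >= 2(w - v)^2]. *)
have : (w - v) ^+ 2 <= v - v ^+ 2 by nra.
rewrite -subr_ge0 => /(mulr_ge0 c20) h5.
nra.
Qed.

End ExponentialBounds.

(** * Sums over random subsets *)

Section SubsetChernoff.
Variables (R : realType) (T : finType).

(* Each m-subset is the image of m! injections 'I_m -> T, so summing over all
   functions 'I_m -> T, which makes the exponential factor, only loses the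
   non-injective ones. *)
Lemma card_subset_sum_ge0 m (u : T -> R) :
  #|[set A : {set T} | (#|A| == m) && (0 <= \sum_(x in A) u x)]|%:R * m`!%:R
    <= (\sum_x expR (u x)) ^+ m.
Proof.
set B := [set A | _].
have -> : (\sum_x expR (u x)) ^+ m =
    \sum_(f : {ffun 'I_m -> T}) \prod_(i < m) expR (u (f i)).
  rewrite -(bigA_distr_bigA (fun=> fun x => expR (u x))).
  by rewrite prodr_const card_ord.
rewrite (partition_big (fun f : {ffun 'I_m -> T} => f @: setT) xpredT) //=.
rewrite mulrC mulr_natr -sumr_const.
apply: (@le_trans _ _ (\sum_(A in B)
    \sum_(f : {ffun 'I_m -> T} | f @: setT == A)
       \prod_(i < m) expR (u (f i)))); last first.
  rewrite [leRHS](bigID (mem B)) /= lerDl.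
  by do 2 apply: sumr_ge0 => ? _; apply: prodr_ge0 => ? _; exact: expR_ge0.
apply: ler_sum => A; rewrite inE => /andP[/eqP cA uA].
have -> : m`! = #|[set f : {ffun 'I_m -> T} in ffun_on A | injectiveb f]|.
  by rewrite card_inj_ffuns_on card_ord cA ffactnn.
have imE (f : {ffun 'I_m -> T}) : f \in ffun_on A -> injective f ->
    f @: setT = A.
  move=> /ffun_onP fA injf; apply/eqP; rewrite eqEcard; apply/andP; split.
    by apply/subsetP => _ /imsetP[i _ ->].
  by rewrite card_imset// cardsT card_ord cA.
rewrite -sumr_const.
apply: (@le_trans _ _ (\sum_(f : {ffun 'I_m -> T} |
    f \in [set f : {ffun 'I_m -> T} in ffun_on A | injectiveb f])
       \prod_(i < m) expR (u (f i)))).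
  apply: ler_sum => f; rewrite inE => /andP[fA /injectiveP injf].
  (* Along an injection with image [A] the product is the exponential of the sum over [A], hence at
     least 1. *)
  rewrite -expR_sum -expR0 ler_expR.
  move: uA; rewrite -(imE f fA injf) big_imset /=; last by move=> ? ? _ _ /injf.
  by under eq_bigl do rewrite inE.
rewrite [leRHS](bigID
  (mem [set f : {ffun 'I_m -> T} in ffun_on A | injectiveb f])) /=.
rewrite -[leLHS]addr0 lerD //; last first.
  by apply: sumr_ge0 => ? _; apply: prodr_ge0 => ? _; exact: expR_ge0.
rewrite le_eqVlt; apply/orP; left; apply/eqP; apply: eq_bigl => f.
apply/idP/andP => [|[]//]; rewrite inE => /[dup] h /andP[fA /injectiveP injf].
by rewrite (imE f fA injf).
Qed.

End SubsetChernoff.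

(** For [N > 0], induction on [m] shows that non-injective sequences form a proportion at most
    [m^2/N], hence at most 1/2. This is the price of comparing subsets with independent samples. *)
Lemma leq_expn_ffact N m : (2 * m ^ 2 <= N)%N -> (N ^ m <= 2 * N ^_ m)%N.
Proof.
move=> mN; have [->|N0] := posnP N.
  by case: m {mN} => [|m]; rewrite ?ffactn0// exp0n.
suff h : (N ^ m * (N - m ^ 2) <= N ^_ m * N)%N.
  rewrite -(leq_pmul2r N0) -mulnA; apply: leq_trans (leq_mul (leqnn 2) h).
  by rewrite mulnCA leq_mul2l; apply/orP; right; lia.
elim: m mN => [|k IH] kN; first by rewrite ffactn0 expn0 exp0n// subn0.
have {}IH := IH ltac:(nia).
rewrite ffactnSr expnSr [leqRHS]mulnAC.
apply: leq_trans (leq_mul IH (leqnn _)).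
rewrite -!mulnA leq_mul2l; apply/orP; right.
have : (k * k <= N)%N by nia.
have : (k <= N)%N by nia.
rewrite -!mulnn; nia.
Qed.

(** * Trigonometric sums on Z/NZ *)

Section ComplexParts.
Variable R : rcfType.
Implicit Types z : R[i].

Lemma Re_sum (I : Type) (r : seq I) (P : pred I) (F : I -> R[i]) :
  Re (\sum_(i <- r | P i) F i) = \sum_(i <- r | P i) Re (F i).
Proof.
elim/big_rec2: _ => [|i y x _ <-]; first exact: erefl.
by case: (F i) x => ? ? [? ?].
Qed.

Lemma sqr_normcE z : normc z ^+ 2 = Re z ^+ 2 + Im z ^+ 2.
Proof. by case: z => a b /=; rewrite sqr_sqrtr// addr_ge0// sqr_ge0. Qed.

Lemma mulcJ z : z * conjc z = (normc z ^+ 2)%:C.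
Proof.
rewrite sqr_normcE; case: z => a b; apply/eqP; rewrite eq_complex /=.
by apply/andP; split; apply/eqP; ring.
Qed.

Lemma conjcM z1 z2 : conjc (z1 * z2) = conjc z1 * conjc z2.
Proof. exact: rmorphM. Qed.

Lemma conjc_sum (I : Type) (r : seq I) (P : pred I) (F : I -> R[i]) :
  conjc (\sum_(i <- r | P i) F i) = \sum_(i <- r | P i) conjc (F i).
Proof. exact: rmorph_sum. Qed.

Lemma normc_ge0 z : 0 <= normc z.
Proof. by case: z => a b; exact: sqrtr_ge0. Qed.

Lemma normcJ z : normc (conjc z) = normc z.
Proof. by case: z => a b; rewrite /= sqrrN. Qed.

Lemma normc_real (x : R) : 0 <= x -> normc x%:C = x.
Proof. by move=> x0; rewrite /= expr0n addr0 sqrtr_sqr ger0_norm. Qed.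

Lemma ler_normc_Re z : `|Re z| <= normc z.
Proof.
by case: z => a b /=; rewrite -sqrtr_sqr ler_wsqrtr// lerDl sqr_ge0.
Qed.

Lemma ler_normc_sum (I : Type) (r : seq I) (P : pred I) (F : I -> R[i]) :
  normc (\sum_(i <- r | P i) F i) <= \sum_(i <- r | P i) normc (F i).
Proof.
elim/big_rec2: _ => [|i y z _ h]; first by rewrite normc0.
by apply: (le_trans (le_normcD _ _)); rewrite lerD2l.
Qed.

End ComplexParts.

Section Characters.
Variable R : realType.
Local Notation C := R[i].

Lemma expiD (a b : R) : expi (a + b) = expi a * expi b.
Proof.
rewrite /expi cosD sinD; apply/eqP; rewrite eq_complex /=.
by rewrite eqxx /= addrC mulrC [X in _ + X]mulrC addrC.
Qed.

Lemma expiN (a : R) : expi (- a) = conjc (expi a).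
Proof. by rewrite /expi cosN sinN. Qed.

Lemma normc_expi (a : R) : normc (expi a) = 1.
Proof. by rewrite /= cos2Dsin2 sqrtr1. Qed.

Lemma expi_2pi_nat n : expi (2 * pi * n%:R : R) = 1.
Proof.
elim: n => [|n IH]; first by rewrite mulr0 /expi cos0 sin0.
rewrite -(natr1 n) mulrDr expiD IH mulr1 mul1r /expi.
by rewrite mulr_natl cos2pi sin2pi.
Qed.

Lemma expi_neq1 (a : R) : 0 < a < 2 * pi -> expi a != 1.
Proof.
move=> /andP[a0 a2]; rewrite eq_complex /= negb_and; apply/orP; left.
have h : 0 < sin (a / 2) by apply: sin_gt0_pi; apply/andP; split; lra.
have -> : a = a / 2 + a / 2 by field.
rewrite cosD -!expr2.
have := cos2Dsin2 (a / 2); have : 0 < sin (a / 2) ^+ 2 by rewrite exprn_gt0.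
by move=> h1 h2; apply/eqP; lra.
Qed.

Variable N : nat.

Definition chi (x : 'Z_N) : C := expi (2 * pi * (x : nat)%:R / N%:R).

Lemma normc_chi x : normc (chi x) = 1. Proof. exact: normc_expi. Qed.

Lemma chi0 : chi 0 = 1.
Proof. by rewrite /chi /= mulr0 mul0r /expi cos0 sin0. Qed.

Hypothesis N1 : (1 < N)%N.

Let N0 : N%:R != 0 :> R. Proof. by rewrite pnatr_eq0; lia. Qed.

Lemma chi_nat k : chi k%:R = expi (2 * pi * k%:R / N%:R).
Proof.
rewrite /chi val_Zp_nat// [in RHS](divn_eq k N) natrD natrM.
have -> : 2 * pi * ((k %/ N)%:R * N%:R + (k %% N)%:R) / N%:R =
   2 * pi * (k %/ N)%:R + 2 * pi * (k %% N)%:R / N%:R :> R by field.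
by rewrite expiD expi_2pi_nat mul1r.
Qed.

Lemma chiD x y : chi (x + y) = chi x * chi y.
Proof.
rewrite -{1}(natr_Zp x) -{1}(natr_Zp y) -natrD chi_nat /chi -expiD.
by congr expi; rewrite natrD; field.
Qed.

Lemma chiN x : chi (- x) = conjc (chi x).
Proof.
have h : chi x * chi (- x) = 1 by rewrite -chiD subrr chi0.
have hJ : chi x * conjc (chi x) = 1 by rewrite mulcJ normc_chi expr1n.
have nz : chi x != 0.
  by apply/eqP => h0; move/eqP: h; rewrite h0 mul0r eq_sym oner_eq0.
by apply: (mulfI nz); rewrite h hJ.
Qed.

Lemma chi_neq1 x : x != 0 -> chi x != 1.
Proof.
move=> x0; apply: expi_neq1.
have xN : (x < N)%N by rewrite -[X in (_ < X)%N](Zp_cast N1) ltn_ord.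
have x1 : (0 < (x : nat))%N.
  by rewrite lt0n; apply: contra x0 => /eqP h; apply/eqP/val_inj.
have p0 := pi_gt0 R.
have NR : 0 < N%:R :> R by rewrite ltr0n; lia.
apply/andP; split; first by rewrite divr_gt0// mulr_gt0 ?ltr0n// mulr_gt0.
by rewrite ltr_pdivrMr// ltr_pM2l ?ltr_nat// mulr_gt0.
Qed.

Lemma sum_chi (d : 'Z_N) : \sum_(w : 'Z_N) chi (d * w) = N%:R * (d == 0)%:R.
Proof.
have [->|d0] := eqVneq d 0.
  under eq_bigr do rewrite mul0r chi0.
  by rewrite sumr_const card_ord Zp_cast// mulr1.
rewrite mulr0; set S := \sum_w _.
(* Translating [w] by 1 multiplies the sum by [chi d], which is not 1. *)
have hS : S = chi d * S.
  rewrite /S mulr_sumr [LHS](reindex_inj (addrI 1)) /=.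
  by apply: eq_bigr => w _; rewrite mulrDr mulr1 chiD.
apply/eqP; have : (chi d - 1) * S = 0 by rewrite mulrBl -hS mul1r subrr.
by move/eqP; rewrite mulf_eq0 subr_eq0 (negbTE (chi_neq1 d0)).
Qed.

(** The index type is arbitrary so that products are again of this form, over product types; moments
    are then read off the zero frequencies. *)
Definition trig_sum (I : finType) (b : I -> C) (d : I -> 'Z_N) (w : 'Z_N) : C :=
  \sum_i b i * chi (d i * w).

Lemma trig_sumM (I J : finType) b (d : I -> 'Z_N) b' (d' : J -> 'Z_N) w :
  trig_sum b d w * trig_sum b' d' w =
  trig_sum (fun p : I * J => b p.1 * b' p.2) (fun p => d p.1 + d' p.2) w.
Proof.
rewrite /trig_sum mulr_suml -(pair_bigA _ (fun i j =>
   b i * b' j * chi ((d i + d' j) * w))) /=.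
apply: eq_bigr => i _; rewrite mulr_sumr; apply: eq_bigr => j _.
by rewrite mulrDl chiD mulrACA.
Qed.

Lemma trig_sumJ (I : finType) b (d : I -> 'Z_N) w :
  conjc (trig_sum b d w) = trig_sum (fun i => conjc (b i)) (fun i => - d i) w.
Proof.
rewrite /trig_sum conjc_sum; apply: eq_bigr => i _.
by rewrite conjcM mulNr chiN.
Qed.

Lemma sum_trig_sum (I : finType) b (d : I -> 'Z_N) :
  \sum_w trig_sum b d w = N%:R * \sum_(i | d i == 0) b i.
Proof.
rewrite /trig_sum exchange_big /= [in RHS]big_mkcond /= mulr_sumr.
apply: eq_bigr => i _; rewrite -mulr_sumr sum_chi.
by case: eqP => _; rewrite ?mulr0 ?mulr1// mulrC.
Qed.

Lemma sum_trig_sum_eq0 (I : finType) b (d : I -> 'Z_N) :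
  (forall i, d i != 0) -> \sum_w trig_sum b d w = 0.
Proof.
by move=> d0; rewrite sum_trig_sum big_pred0 ?mulr0// => i; exact: negbTE.
Qed.

Section Moments.
Variables (I : finType) (b : I -> C) (d : I -> 'Z_N).
Local Notation h := (trig_sum b d).

Lemma sum_Re_trig_sum : (forall i, d i != 0) -> \sum_w Re (h w) = 0.
Proof. by move=> d0; rewrite -Re_sum sum_trig_sum_eq0. Qed.

(** Parseval: the frequency [d i - d j] vanishes only on the diagonal. *)
Lemma sum_sqr_normc_trig_sum : injective d ->
  \sum_w normc (h w) ^+ 2 = N%:R * \sum_i normc (b i) ^+ 2.
Proof.
move=> injd; apply: (@complexI R).
rewrite rmorphM rmorph_nat !rmorph_sum /=.
under eq_bigr do rewrite -mulcJ trig_sumJ trig_sumM.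
rewrite sum_trig_sum; congr (_ * _).
rewrite -(pair_big_dep xpredT (fun i j => d i - d j == 0)
  (fun i j => b i * conjc (b j))) /=.
apply: eq_bigr => i _; rewrite (big_pred1 i) ?mulcJ// => j /=.
by rewrite subr_eq0 eq_sym (inj_eq injd).
Qed.

(** [(Re h)^2 = |h|^2/2 + Re (h^2)/2], and [h^2] has the nonzero frequencies [d i + d j]. *)
Lemma sum_sqr_Re_trig_sum : (forall i j, d i + d j != 0) ->
  \sum_w Re (h w) ^+ 2 = (\sum_w normc (h w) ^+ 2) / 2.
Proof.
move=> dd; have : \sum_w Re (h w * h w) = 0.
  rewrite -Re_sum; under eq_bigr do rewrite trig_sumM.
  by rewrite sum_trig_sum_eq0// => -[i j]; exact: dd.
have E w : Re (h w) ^+ 2 = normc (h w) ^+ 2 / 2 + Re (h w * h w) / 2.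
  by rewrite sqr_normcE; case: (h w) => x y /=; field.
under [in X in _ -> X]eq_bigr do rewrite E.
by rewrite big_split /= -!mulr_suml => ->; rewrite mul0r addr0.
Qed.

(** [Re h |h|^2] is the real part of [h^2 conj h], whose frequencies are [d i + d j - d k]. *)
Lemma sum_Re_sqr_normc_trig_sum : (forall i j k, d i + d j - d k != 0) ->
  \sum_w Re (h w) * normc (h w) ^+ 2 = 0.
Proof.
move=> ddd.
have E w : Re (h w) * normc (h w) ^+ 2 = Re (h w * h w * conjc (h w)).
  by rewrite sqr_normcE; case: (h w) => x y /=; ring.
under eq_bigr do rewrite E trig_sumJ !trig_sumM.
by rewrite -Re_sum sum_trig_sum_eq0// => -[[i j] k]; exact: ddd.
Qed.

End Moments.
End Characters.

(** * The defect and its Laplace transform *)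

Section UnitVectors.
Variable R : realType.
Local Notation C := R[i].

(* The scaling makes the l1 norm at most 1, whence every trigonometric sum with
   such coefficients is bounded by 1. *)
Definition unit_coeffs s (b : 'I_s -> C) :=
  \sum_j normc (b j) ^+ 2 = s%:R^-1.

Lemma sum_normc_le1 s (b : 'I_s -> C) : (0 < s)%N ->
  \sum_j normc (b j) ^+ 2 <= s%:R^-1 -> \sum_j normc (b j) <= 1.
Proof.
move=> s0 hb; have sR : 0 < s%:R :> R by rewrite ltr0n.
(* AM-GM weighted for equality at [|b j| = 1/s]; after summation each of the two terms contributes
   at most 1/2. *)
have h j : normc (b j) <= s%:R / 2 * normc (b j) ^+ 2 + (2 * s%:R)^-1.
  rewrite -subr_ge0.
  have -> : s%:R / 2 * normc (b j) ^+ 2 + (2 * s%:R)^-1 - normc (b j) =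
     (s%:R * normc (b j) - 1) ^+ 2 / (2 * s%:R) by field; rewrite gt_eqF.
  by rewrite divr_ge0 ?sqr_ge0// mulr_ge0// ltW.
apply: (le_trans (ler_sum _ (fun j _ => h j))).
rewrite big_split /= -mulr_sumr sumr_const card_ord -[X in _ + X <= _]mulr_natr.
have -> : (2 * s%:R)^-1 * s%:R = 2^-1 :> R by field; rewrite gt_eqF.
have : s%:R / 2 * (\sum_j normc (b j) ^+ 2) <= s%:R / 2 * s%:R^-1.
  by rewrite ler_pM2l// divr_gt0.
have -> : s%:R / 2 * s%:R^-1 = 2^-1 :> R by field; rewrite gt_eqF.
lra.
Qed.

Lemma unit_coeffs_cst s : (0 < s)%N ->
  unit_coeffs (fun _ : 'I_s => (s%:R^-1 : R)%:C).
Proof.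
move=> s0; have sR : 0 < s%:R :> R by rewrite ltr0n.
rewrite /unit_coeffs; under eq_bigr do rewrite normc_real ?invr_ge0 ?ler0n//.
by rewrite sumr_const card_ord -[LHS]mulr_natr; field; rewrite gt_eqF.
Qed.

Lemma normc_trig_sum_le N (I : finType) (b : I -> C) (d : I -> 'Z_N) w :
  normc (trig_sum b d w) <= \sum_i normc (b i).
Proof.
apply: (le_trans (ler_normc_sum _ _ _)); apply: ler_sum => i _.
by rewrite normcM normc_chi mulr1.
Qed.

Definition defect (z : C) : R := Re z - normc z ^+ 2.

Lemma ler_dist_normc (x y : C) : `|normc x - normc y| <= normc (x - y).
Proof. exact: (@ler_dist_dist R (Rcomplex R) x y). Qed.

(** The real part contributes 1 to the constant, the squared modulus [|x| + |y| <= 2]. *)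
Lemma defect_lipschitz (x y : C) : normc x <= 1 -> normc y <= 1 ->
  defect x <= defect y + 3 * normc (x - y).
Proof.
move=> x1 y1; have := ler_dist_normc x y; have := ler_normc_Re (x - y).
have -> : Re (x - y) = Re x - Re y by case: x {x1} y {y1} => ? ? [? ?].
rewrite /defect !ler_norml => /andP[_ h1] /andP[h2 h3].
have := normc_ge0 x; have := normc_ge0 y; nra.
Qed.

End UnitVectors.

Section MomentGeneratingFunction.
Variables (R : realType) (N s : nat).
Hypotheses (N1 : (1 < N)%N) (s0 : (0 < s)%N).
Variables (b : 'I_s -> R[i]) (d : 'I_s -> 'Z_N).
Hypotheses (b1 : unit_coeffs b) (injd : injective d).
Hypothesis d0 : forall j, d j != 0.

Local Notation g := (trig_sum b d).

Let sR : 0 < s%:R :> R. Proof. by rewrite ltr0n. Qed.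

Lemma unit_trig_sum_le1 w : normc (g w) <= 1.
Proof.
apply: (le_trans (normc_trig_sum_le _ _ _)).
by apply: sum_normc_le1; rewrite ?b1.
Qed.

(** The linear term is exact: [Re g] has mean 0 and [|g|^2] has mean [1/s]. The parameters [x] and
    [y] bound the two moments that depend on additive relations between the [d j]. *)
Lemma sum_expR_defect (c x y : R) : 0 <= c <= 2 / 3 ->
  \sum_w Re (g w) ^+ 2 <= N%:R * x ->
  - y * N%:R <= \sum_w Re (g w) * normc (g w) ^+ 2 ->
  \sum_w expR (c * defect (g w)) <=
    N%:R * (1 - c / s%:R + c ^+ 2 / 2 * (x + 2 * y + s%:R^-1)).
Proof.
move=> c01 hx hy.
have E w : expR (c * defect (g w)) <= 1 + c * (Re (g w) - normc (g w) ^+ 2) +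
    c ^+ 2 / 2 * (Re (g w) ^+ 2 - 2 * (Re (g w) * normc (g w) ^+ 2)
                  + normc (g w) ^+ 2).
  apply: expR_le_second_order => //; apply/andP; split.
    by rewrite sqr_normcE lerDl sqr_ge0.
  by rewrite expr_le1// ?normc_ge0// unit_trig_sum_le1.
apply: (le_trans (ler_sum _ (fun w _ => E w))).
rewrite big_split big_split /= -!mulr_sumr big_split /= big_split /= sumrB.
rewrite sumrN -mulr_sumr (sum_Re_trig_sum N1)// (sum_sqr_normc_trig_sum N1)// b1.
have -> : \sum_(w : 'Z_N) (1 : R) = N%:R by rewrite sumr_const card_ord Zp_cast.
set X := \sum_w _ in hx *; set Y := \sum_w _ in hy *.
have c2 : 0 <= c ^+ 2 / 2 by rewrite divr_ge0// sqr_ge0.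
have : c ^+ 2 / 2 * (X - 2 * Y + N%:R / s%:R) <=
    c ^+ 2 / 2 * (N%:R * x + 2 * (y * N%:R) + N%:R / s%:R).
  by rewrite ler_wpM2l//; lra.
move=> h; apply: (le_trans (lerD (lexx _) h)).
by rewrite le_eqVlt; apply/orP; left; apply/eqP; field; rewrite gt_eqF.
Qed.

(** From [(Re g)^2 <= |g|^2] and [Re g >= -1] one may take [x = y = 1/s]; then [-c + 2c^2] is
    minimal, equal to -1/8, at [c = 1/4]. *)
Lemma sum_expR_defect_any :
  \sum_w expR (1 / 4 * defect (g w)) <= N%:R * (1 - (8 * s%:R)^-1).
Proof.
have hV : \sum_w normc (g w) ^+ 2 = N%:R * s%:R^-1.
  by rewrite (sum_sqr_normc_trig_sum N1)// b1.
have hW w : normc (g w) ^+ 2 * (Re (g w) + 1) >= 0.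
  rewrite mulr_ge0 ?sqr_ge0//; have := ler_normc_Re (g w).
  by rewrite ler_norml; have := unit_trig_sum_le1 w; lra.
apply: (le_trans (sum_expR_defect (x := s%:R^-1) (y := s%:R^-1) _ _ _)).
- by apply/andP; split; lra.
- rewrite -hV; apply: ler_sum => w _.
  by rewrite sqr_normcE lerDl sqr_ge0.
- rewrite mulNr mulrC -hV -sumrN; apply: ler_sum => w _.
  by have := hW w; lra.
by rewrite le_eqVlt; apply/orP; left; apply/eqP; field; rewrite gt_eqF.
Qed.

(** With [x = 1/(2s)] and [y = 0], [-c + 3c^2/4] is minimal, equal to -1/3, at [c = 2/3], the
    largest [c] that the second order bound admits. *)
Lemma sum_expR_defect_generic :
  (forall i j, d i + d j != 0) -> (forall i j k, d i + d j - d k != 0) ->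
  \sum_w expR (2 / 3 * defect (g w)) <= N%:R * (1 - (3 * s%:R)^-1).
Proof.
move=> dd ddd.
apply: (le_trans (sum_expR_defect (x := (2 * s%:R)^-1) (y := 0) _ _ _)).
- by apply/andP; split; lra.
- rewrite (sum_sqr_Re_trig_sum N1)// (sum_sqr_normc_trig_sum N1)// b1.
  by rewrite le_eqVlt; apply/orP; left; apply/eqP; field; rewrite gt_eqF.
- by rewrite (sum_Re_sqr_normc_trig_sum N1)// oppr0 mul0r.
by rewrite le_eqVlt; apply/orP; left; apply/eqP; field; rewrite gt_eqF.
Qed.

End MomentGeneratingFunction.

(** * A finite net of coefficient vectors *)

Section Net.
Variable R : realType.
Local Notation C := R[i].

Lemma normc_le_ReIm (z : C) : normc z <= `|Re z| + `|Im z|.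
Proof.
rewrite -(ler_pXn2r (n := 2)) ?nnegrE ?normc_ge0 ?addr_ge0//.
rewrite sqr_normcE sqrrD !real_normK ?num_real//.
by rewrite [_ + _ + Im z ^+ 2]addrAC lerDl mulrn_wge0// mulr_ge0.
Qed.

Lemma ler_normc_Im (z : C) : `|Im z| <= normc z.
Proof.
by case: z => a b /=; rewrite -sqrtr_sqr ler_wsqrtr// lerDr sqr_ge0.
Qed.

Lemma truncn_eq_dist (x y : R) : 0 <= x -> 0 <= y ->
  Num.truncn x = Num.truncn y -> `|x - y| <= 1.
Proof.
move=> x0 y0 e; have := truncn_itv x0; have := truncn_itv y0.
rewrite e -natr1 => /andP[? ?] /andP[? ?].
by rewrite ler_norml; apply/andP; split; lra.
Qed.

(** Real and imaginary parts are rounded to a grid of mesh [h = eps/(2s)]. Each occupied cell is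
    represented by a unit vector lying in it, so that the net consists of unit vectors; empty cells
    get the constant vector. *)
Lemma unit_coeffs_net s (eps : R) : (0 < s)%N -> 0 < eps ->
  exists (F : finType) (net : F -> 'I_s -> C),
    (forall k, unit_coeffs (net k)) /\
    forall b : 'I_s -> C, unit_coeffs b ->
      exists k, \sum_j normc (b j - net k j) <= eps.
Proof.
move=> s0 eps0; have sR : 0 < s%:R :> R by rewrite ltr0n.
pose h : R := eps / (2 * s%:R).
have h0 : 0 < h by rewrite divr_gt0// mulr_gt0.
pose M := (Num.truncn (2 / h)).+1.
pose rnd (x : R) : 'I_M := inord (Num.truncn ((x + 1) / h)).
have rndP x y : `|x| <= 1 -> `|y| <= 1 -> rnd x = rnd y -> `|x - y| <= h.
  move=> x1 y1 e.
  have b01 z : `|z| <= 1 -> 0 <= (z + 1) / h <= 2 / h.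
    rewrite ler_norml => /andP[? ?].
    apply/andP; split; first by apply: divr_ge0; [lra|exact: ltW].
    by rewrite ler_pM2r ?invr_gt0//; lra.
  have bM z : `|z| <= 1 -> (Num.truncn ((z + 1) / h) < M)%N.
    by move=> /b01/andP[_ zh]; rewrite ltnS; apply: le_truncn.
  have : Num.truncn ((x + 1) / h) = Num.truncn ((y + 1) / h).
    by move: (congr1 val e); rewrite /= !inordK// bM.
  have /andP[px _] := b01 _ x1; have /andP[py _] := b01 _ y1.
  move=> /(truncn_eq_dist px py).
  have -> : (x + 1) / h - (y + 1) / h = (x - y) / h.
    by rewrite -mulrBl; congr (_ / _); ring.
  by rewrite normrM normfV (gtr0_norm h0) ler_pdivrMr// mul1r.
pose F := {ffun 'I_s -> 'I_M * 'I_M}.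
pose cell (b : 'I_s -> C) : F := [ffun j => (rnd (Re (b j)), rnd (Im (b j)))].
have /boolp.choice[net netP] : forall k : F, exists b : 'I_s -> C,
    unit_coeffs b /\
    ((exists b', unit_coeffs b' /\ cell b' = k) -> cell b = k).
  move=> k.
  have [[b [b1 bk]]|nb] := pselect (exists b, unit_coeffs b /\ cell b = k).
    by exists b.
  by exists (fun=> (s%:R^-1)%:C); split; [exact: unit_coeffs_cst|move=> /nb].
exists F, net; split=> [k|b b1]; first by have [] := netP k.
have [n1 nE] := netP (cell b); exists (cell b).
have {}nE : cell (net (cell b)) = cell b by apply: nE; exists b.
have bound (a : 'I_s -> C) j : unit_coeffs a -> normc (a j) <= 1.
  move=> a1; have h1 : \sum_i normc (a i) <= 1.
    by apply: sum_normc_le1 => //; rewrite a1.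
  apply: le_trans h1.
  by rewrite (bigD1 j)//= lerDl sumr_ge0// => i _; exact: normc_ge0.
apply: (@le_trans _ _ (\sum_(j < s) (2 * h))); last first.
  rewrite sumr_const card_ord -[leLHS]mulr_natr /h le_eqVlt.
  by apply/orP; left; apply/eqP; field; rewrite gt_eqF.
apply: ler_sum => j _; apply: (le_trans (normc_le_ReIm _)).
move/ffunP: nE => /(_ j); rewrite !ffunE => -[eR eI].
have -> : Re (b j - net (cell b) j) = Re (b j) - Re (net (cell b) j).
  by case: (b j) (net _ j) => ? ? [].
have -> : Im (b j - net (cell b) j) = Im (b j) - Im (net (cell b) j).
  by case: (b j) (net _ j) => ? ? [].
rewrite mulr_natl mulr2n lerD// rndP//;
  first [apply: (le_trans (ler_normc_Re _)) | apply: (le_trans (ler_normc_Im _))];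
  exact: bound.
Qed.

End Net.

(** * Recovery from the separation condition *)

Section Recovery.
Variables (R : realType) (N : nat).
Hypothesis N1 : (1 < N)%N.
Local Notation C := R[i].

Lemma trig_sumZ (I : finType) (k : C) (b : I -> C) (d : I -> 'Z_N) w :
  trig_sum (fun i => k * b i) d w = k * trig_sum b d w.
Proof.
by rewrite /trig_sum mulr_sumr; apply: eq_bigr => i _; rewrite mulrA.
Qed.

Lemma complex_phase (x : C) :
  exists2 k : C, normc k = 1 & k * x = (normc x)%:C.
Proof.
have [->|x0] := eqVneq x 0.
  by exists 1; [exact: normc1|rewrite normc0 mulr0].
have nx0 : normc x != 0 by apply: contra x0 => /eqP/eq0_normc ->.
exists ((normc x)^-1%:C * conjc x).
  by rewrite normcM normc_real ?invr_ge0 ?normc_ge0// normcJ mulVf.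
rewrite -mulrA [conjc x * x]mulrC mulcJ -rmorphM /=; congr (_%:C).
by rewrite expr2 mulKf.
Qed.

Lemma fourier_chi (x : {ffun 'Z_N -> C}) w :
  fourier x w = ((Num.sqrt N%:R)^-1)%:C * \sum_t x t * conjc (chi R (t * w)).
Proof.
rewrite /fourier; congr (_ * _); apply: eq_bigr => t _; congr (_ * _).
by rewrite expiN -(chi_nat R N1) natrM !natr_Zp.
Qed.

Section NullSpace.
Variables (s : nat) (u : 'I_s -> 'Z_N) (S Om : {set 'Z_N}).
Hypotheses (s0 : (0 < s)%N) (inju : injective u) (SE : S = u @: setT).
Hypothesis SN : exists t, t \notin S.
Hypothesis separated : forall t, t \notin S -> forall b : 'I_s -> C,
  unit_coeffs b -> \sum_(w in Om) defect (trig_sum b (fun j => u j - t) w) < 0.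

(** With [p] the transform of [z] restricted to [S] and [Q] the sum of [|p|^2] over [Om], separation
    gives [|X t| < tau Q] off [S], while the vanishing of the transform of [z] on [Om] gives
    [Q = - sum z(t) X(t)] over [t] off [S]. These conflict unless [z] has more mass off [S] than on
    it. *)
Lemma null_space_property (z : 'Z_N -> C) :
  (forall w, w \in Om -> \sum_t z t * conjc (chi R (t * w)) = 0) ->
  (exists t, z t != 0) ->
  \sum_(t in S) normc (z t) < \sum_(t | t \notin S) normc (z t).
Proof.
move=> zOm [t1 zt1]; have sR : 0 < s%:R :> R by rewrite ltr0n.
have sumS (V : nmodType) (F : 'Z_N -> V) :
    \sum_(t in S) F t = \sum_j F (u j).
  rewrite SE big_imset /=; last by move=> ? ? _ _ /inju.
  by apply: eq_bigl => j; rewrite inE.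
pose a j := conjc (z (u j)).
pose A := \sum_j normc (a j) ^+ 2.
have A0 : 0 <= A by apply: sumr_ge0 => j _; exact: sqr_ge0.
have normJ : \sum_(t in S) normc (z t) = \sum_j normc (a j).
  by rewrite sumS; apply: eq_bigr => j _; rewrite normcJ.
(* If [z] vanishes on [S], the left side is 0 and [t1] lies outside [S]. *)
have [A_eq0|A_neq0] := eqVneq A 0.
  have a0 j : a j = 0.
    have /eqP : normc (a j) ^+ 2 = 0.
      by move: A_eq0 => /psumr_eq0P -> // i _; exact: sqr_ge0.
    by rewrite sqrf_eq0 => /eqP/eq0_normc.
  rewrite normJ big1; last by move=> j _; rewrite a0 normc0.
  have t1S : t1 \notin S.
    apply: contra zt1; rewrite SE => /imsetP[j _ ->].
    by have := a0 j; rewrite /a => /(congr1 conjc); rewrite conjcK conjc0 => ->.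
  rewrite (bigD1 t1)//= ltr_wpDr//.
    by apply: sumr_ge0 => *; exact: normc_ge0.
  rewrite lt_neqAle normc_ge0 andbT eq_sym.
  by apply: contra zt1 => /eqP/eq0_normc ->.
have A_gt0 : 0 < A by rewrite lt_neqAle eq_sym A_neq0.
(* This scaling makes [tau * a] a unit vector. *)
pose tau : R := Num.sqrt (s%:R * A)^-1.
have tau0 : 0 < tau by rewrite sqrtr_gt0 invr_gt0 mulr_gt0.
have tau2 : tau ^+ 2 * A = s%:R^-1.
  rewrite sqr_sqrtr ?invr_ge0 ?mulr_ge0// 1?ltW//.
  by field; rewrite !gt_eqF.
have tauS : tau * \sum_(t in S) normc (z t) <= 1.
  rewrite normJ mulr_sumr.
  have -> : \sum_j tau * normc (a j) = \sum_j normc (tau%:C * a j).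
    by apply: eq_bigr => j _; rewrite normcM normc_real// ltW.
  apply: sum_normc_le1 => //; rewrite le_eqVlt -tau2 /A mulr_sumr.
  apply/orP; left; apply/eqP; apply: eq_bigr => j _.
  by rewrite normcM normc_real ?exprMn// ltW.
pose p w := \sum_(t in S) z t * conjc (chi R (t * w)).
pose Q := \sum_(w in Om) normc (p w) ^+ 2.
have hE t w : trig_sum a (fun j => u j - t) w =
    conjc (p w) * conjc (chi R (t * w)).
  rewrite /p sumS conjc_sum mulr_suml; apply: eq_bigr => j _.
  rewrite conjcM conjcK mulrBl (chiD R N1) (chiN R N1).
  by rewrite mulrA.
pose X t := \sum_(w in Om) conjc (p w) * conjc (chi R (t * w)).
(* Separation is applied to [tau k a], where the phase [k] makes [k X t] equal to [|X t|]; the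
   defects then sum to [tau |X t| - tau^2 Q]. *)
have XQ t : t \notin S -> normc (X t) < tau * Q.
  move=> tS; have [k k1 kX] := complex_phase (X t).
  have /(separated tS) : unit_coeffs (fun j => tau%:C * (k * a j)).
    rewrite /unit_coeffs -tau2 /A mulr_sumr; apply: eq_bigr => j _.
    by rewrite !normcM k1 mul1r normc_real ?exprMn// ltW.
  rewrite /defect sumrB -Re_sum.
  have -> : \sum_(w in Om) trig_sum (fun j => tau%:C * (k * a j))
      (fun j => u j - t) w = (tau * normc (X t))%:C.
    rewrite rmorphM /= -kX /X !mulr_sumr; apply: eq_bigr => w _.
    by rewrite !trig_sumZ hE.
  have -> : \sum_(w in Om) normc (trig_sum (fun j => tau%:C * (k * a j))
      (fun j => u j - t) w) ^+ 2 = tau ^+ 2 * Q.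
    rewrite /Q mulr_sumr; apply: eq_bigr => w _.
    rewrite !trig_sumZ hE !normcM k1 mul1r !normcJ normc_chi mulr1.
    by rewrite normc_real ?exprMn// ltW.
  by rewrite /= expr2 -mulrA -mulrBr pmulr_rlt0// subr_lt0.
have Q0 : 0 < Q.
  have [t tS] := SN; rewrite -(pmulr_rgt0 _ tau0).
  by apply: le_lt_trans (XQ t tS); exact: normc_ge0.
have QE : Q%:C = - \sum_(t | t \notin S) z t * X t.
  rewrite /Q rmorph_sum /=.
  have pE w : w \in Om ->
      p w = - \sum_(t | t \notin S) z t * conjc (chi R (t * w)).
    move=> /zOm; rewrite (bigID (mem S)) /= => /eqP.
    by rewrite addr_eq0 => /eqP.
  under eq_bigr => w wOm do rewrite -mulcJ {1}pE// mulNr mulr_suml.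
  rewrite sumrN exchange_big /=; congr (- _); apply: eq_bigr => t _.
  by rewrite /X mulr_sumr; apply: eq_bigr => w _; rewrite mulrAC mulrA.
have QX : Q <= \sum_(t | t \notin S) normc (z t) * normc (X t).
  have -> : Q = normc Q%:C by rewrite normc_real// ltW.
  rewrite QE normcN; apply: (le_trans (ler_normc_sum _ _ _)).
  by apply: ler_sum => t _; rewrite normcM.
(* Otherwise [tau] times the mass of [z] off [S] is at most 1, which forces every
   [|z t| (tau Q - |X t|)] to vanish; so [z = 0] off [S], contradicting [0 < Q]. *)
rewrite ltNge; apply/negP => hle.
have tauZ : tau * (\sum_(t | t \notin S) normc (z t)) <= 1.
  by apply: le_trans tauS; rewrite ler_pM2l.
have terms0 t : t \notin S -> 0 <= normc (z t) * (tau * Q - normc (X t)).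
  by move=> tS; rewrite mulr_ge0 ?normc_ge0// subr_ge0 ltW// XQ.
have sum0 : \sum_(t | t \notin S) normc (z t) * (tau * Q - normc (X t)) = 0.
  apply/eqP; rewrite eq_le sumr_ge0// andbT.
  under eq_bigr do rewrite mulrBr.
  rewrite sumrB -mulr_suml subr_le0; apply: le_trans QX.
  rewrite mulrA -[leRHS]mul1r ler_pM2r// mulrC.
  exact: tauZ.
have z0 t : t \notin S -> normc (z t) = 0.
  move=> tS; apply/eqP.
  have /eqP := psumr_eq0P terms0 sum0 tS.
  by rewrite mulf_eq0 subr_eq0 (gt_eqF (XQ t tS)) orbF.
move: QX; rewrite big1 ?leNgt ?Q0// => t tS.
by rewrite z0// mul0r.
Qed.

(** With [z = y - x], the triangle inequality on [S] and [z = y] off [S] reduce the claim to the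
    null space property. *)
Lemma property_i_of_separated (x : {ffun 'Z_N -> C}) :
  carried_by S x -> property_i Om x.
Proof.
move=> xS y yx yxOm; pose z t := y t - x t.
have zOm w : w \in Om -> \sum_t z t * conjc (chi R (t * w)) = 0.
  move=> wOm; have := yxOm w wOm; rewrite !fourier_chi => /mulfI h.
  have /h E : ((Num.sqrt N%:R : R)^-1)%:C != 0.
    rewrite eq_complex /= eqxx andbT invr_eq0 gt_eqF// sqrtr_gt0 ltr0n.
    exact: ltnW.
  by rewrite /z; under eq_bigr do rewrite mulrBl; rewrite sumrB E subrr.
have zn0 : exists t, z t != 0.
  apply/existsP; rewrite -negb_forall; apply/negP => /forallP h.
  by apply: yx; apply/ffunP => t; apply/eqP; rewrite -subr_eq0; exact: h.
have np := null_space_property zOm zn0.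
rewrite /l1norm [ltLHS](bigID (mem S)) /= [ltRHS](bigID (mem S)) /=.
rewrite [X in _ + X < _]big1 ?addr0; last first.
  by move=> t tS; rewrite (xS t tS) normc0.
have zy : \sum_(t | t \notin S) normc (z t) = \sum_(t | t \notin S) normc (y t).
  by apply: eq_bigr => t tS; rewrite /z (xS t tS) subr0.
have : \sum_(t in S) normc (x t) <=
    \sum_(t in S) normc (y t) + \sum_(t in S) normc (z t).
  rewrite -big_split /=; apply: ler_sum => t _.
  have -> : x t = y t - z t by rewrite /z opprB addrC subrK.
  by rewrite -[normc (z t)]normcN; exact: le_normcD.
move: np; rewrite zy; lra.
Qed.

End NullSpace.
End Recovery.

(** * Union bound *)

Lemma leq_card_bigcup (I T : finType) (B : I -> {set T}) :
  (#|\bigcup_i B i| <= \sum_i #|B i|)%N.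
Proof.
elim/big_rec2: _ => [|i n A _ h]; first by rewrite cards0.
by apply: leq_trans (leq_card_setU _ _) _; rewrite leq_add2l.
Qed.

(** The representative of [v] is twice that of [t], possibly less one modulus; so [t + t = v] has at
    most two solutions. *)
Lemma Zp_double_inv N (t v : 'Z_N) : t + t = v ->
  exists b : bool, t = inZp ((v + b * (Zp_trunc N).+2)./2).
Proof.
move=> <-; have tN := ltn_ord t.
have vE : (t + t)%R = ((t + t) %% (Zp_trunc N).+2)%N :> nat by [].
exists ((Zp_trunc N).+2 <= t + t)%N; rewrite vE -[LHS]valZpK; congr inZp.
case: leqP => h; first by rewrite modn_small// addn0; lia.
have -> : ((t + t) %% (Zp_trunc N).+2 = t + t - (Zp_trunc N).+2)%N.
  rewrite -{1}(subnK h) modnDr modn_small//; lia.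
lia.
Qed.

Section UnionBound.
Variables (R : realType) (N s : nat).
Hypotheses (N1 : (1 < N)%N) (s0 : (0 < s)%N).
Variable u : 'I_s -> 'Z_N.
Hypothesis inju : injective u.
Local Notation C := R[i].

Definition generic (t : 'Z_N) :=
  [forall i, forall j, (u i - t) + (u j - t) != 0] &&
  [forall i, forall j, forall k, (u i - t) + (u j - t) - (u k - t) != 0].

(** Each pair [(i, j)] excludes at most two solutions of [2t = u i + u j], each triple only
    [t = u i + u j - u k]. *)
Lemma card_not_generic :
  (#|[set t | ~~ generic t]| <= 2 * s ^ 2 + s ^ 3)%N.
Proof.
pose f (p : 'I_s * 'I_s * bool) : 'Z_N :=
  inZp (((u p.1.1 + u p.1.2)%R + p.2 * (Zp_trunc N).+2)./2)%N.
pose g (p : 'I_s * 'I_s * 'I_s) : 'Z_N := u p.1.1 + u p.1.2 - u p.2.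
apply: (@leq_trans #|(f @: setT) :|: (g @: setT)|).
  apply/subset_leq_card/subsetP => t; rewrite !inE negb_and => /orP[].
    move=> h0; have [i hi] := @forallPn _ _ h0; have [j] := @forallPn _ _ hi.
    rewrite negbK => /eqP h; apply/orP; left.
    have /Zp_double_inv[b tE] : t + t = u i + u j.
      by apply/eqP; rewrite eq_sym -subr_eq0 -h; apply/eqP; ring.
    by rewrite tE; apply/imsetP; exists (i, j, b).
  move=> h0; have [i hi] := @forallPn _ _ h0; have [j hj] := @forallPn _ _ hi.
  have [k] := @forallPn _ _ hj; rewrite negbK => /eqP h.
  apply/orP; right; apply/imsetP; exists (i, j, k) => //.
  by apply/eqP; rewrite eq_sym -subr_eq0 -h /g /=; apply/eqP; ring.
apply: leq_trans (leq_card_setU _ _) _; apply: leq_add.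
  apply: leq_trans (leq_imset_card _ _) _.
  by rewrite cardsT !card_prod card_bool !card_ord -mulnn mulnC.
apply: leq_trans (leq_imset_card _ _) _.
by rewrite cardsT !card_prod !card_ord expnS -mulnn mulnA.
Qed.

(* The factor 3 is the Lipschitz constant of the defect. *)
Lemma chernoff_defect m (t : 'Z_N) (b : 'I_s -> C) (c eta rho r : R) :
  0 <= c <= 1 -> 0 <= eta -> 3 * eta - rho <= - r ->
  \sum_w expR (c * defect (trig_sum b (fun j => u j - t) w)) <=
    N%:R * (1 - rho) ->
  #|[set A : {set 'Z_N} | (#|A| == m) &&
      (0 <= \sum_(w in A)
         (defect (trig_sum b (fun j => u j - t) w) + 3 * eta) * c)]|%:R * m`!%:R
    <= N%:R ^+ m * expR (- r * m%:R).
Proof.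
move=> /andP[c0 c1] eta0 hr hsum; apply: (le_trans (card_subset_sum_ge0 _ _)).
rewrite expRM_natr -exprMn; apply: lerXn2r; rewrite ?nnegrE.
- by apply: sumr_ge0 => w _; exact: expR_ge0.
- by rewrite mulr_ge0 ?expR_ge0.
under eq_bigr do rewrite mulrDl expRD [_ * c]mulrC.
rewrite -mulr_suml.
have h1 : 1 - rho <= expR (- rho) by exact: expR_ge1Dx.
have h2 : expR (3 * eta * c) <= expR (3 * eta).
  by rewrite ler_expR ler_piMr// mulr_ge0.
apply: (@le_trans _ _ (N%:R * expR (- rho) * expR (3 * eta))).
  apply: ler_pM => //; rewrite ?expR_ge0//.
    by apply: sumr_ge0 => w _; exact: expR_ge0.
  by apply: (le_trans hsum); rewrite ler_wpM2l.
rewrite -mulrA -expRD ler_wpM2l// ler_expR; lra.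
Qed.

Definition unseparated (S Om : {set 'Z_N}) :=
  exists t : 'Z_N, t \notin S /\ exists b : 'I_s -> C, unit_coeffs b /\
    0 <= \sum_(w in Om) defect (trig_sum b (fun j => u j - t) w).

Variables (F : finType) (net : F -> 'I_s -> C).
Hypothesis net1 : forall k, unit_coeffs (net k).
(** Of order [1/s^2], like the gap between [1/(3s)] and [1/(3s+2)] that has to absorb [3 eta]. *)
Let eta : R := (100 * s%:R ^+ 2)^-1.
Hypothesis netP : forall b : 'I_s -> C, unit_coeffs b ->
  exists k, \sum_j normc (b j - net k j) <= eta.

Lemma margin_generic : 3 * eta - (3 * s%:R)^-1 <= - (3 * s + 2)%:R^-1.
Proof.
have sR : 1 <= s%:R :> R by rewrite ler1n.
rewrite /eta natrD natrM; move: (s%:R : R) sR => x x1.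
rewrite -subr_le0.
have -> : 3 * (100 * x ^+ 2)^-1 - (3 * x)^-1 - - (3 * x + 2)^-1 =
    (9 * (3 * x + 2) - 200 * x) / (300 * x ^+ 2 * (3 * x + 2)).
  by field; rewrite !gt_eqF//; lra.
by rewrite pmulr_lle0 ?invr_gt0 ?mulr_gt0 ?exprn_gt0//; lra.
Qed.

(** A quarter of the generic target rate, so that [(3s+2) C log N] samples give [N^(-C/4)]. *)
Lemma margin_any : 3 * eta - (8 * s%:R)^-1 <= - (4 * (3 * s + 2)%:R)^-1.
Proof.
have sR : 1 <= s%:R :> R by rewrite ler1n.
rewrite /eta natrD natrM; move: (s%:R : R) sR => x x1.
rewrite -subr_le0.
have -> : 3 * (100 * x ^+ 2)^-1 - (8 * x)^-1 - - (4 * (3 * x + 2))^-1 =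
    (6 * (3 * x + 2) - 25 * x * (3 * x + 2) + 50 * x ^+ 2)
    / (200 * x ^+ 2 * (3 * x + 2)).
  by field; rewrite !gt_eqF//; lra.
by rewrite pmulr_lle0 ?invr_gt0 ?mulr_gt0 ?exprn_gt0//; nra.
Qed.

Lemma card_unseparated m (S : {set 'Z_N}) : (forall j, u j \in S) ->
  #|[set Om : {set 'Z_N} | (#|Om| == m) && `[< unseparated S Om >]]|%:R * m`!%:R
  <= (#|F|%:R : R) * N%:R ^+ m *
     (N%:R * expR (- (3 * s + 2)%:R^-1 * m%:R) +
      (2 * s ^ 2 + s ^ 3)%:R * expR (- (4 * (3 * s + 2)%:R)^-1 * m%:R)).
Proof.
move=> uS; have sR : 1 <= s%:R :> R by rewrite ler1n.
have eta0 : 0 <= eta by rewrite invr_ge0 mulr_ge0// sqr_ge0.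
pose c t : R := if generic t then 2 / 3 else 1 / 4.
have c0 t : 0 < c t by rewrite /c; case: ifP => _; lra.
pose B (p : 'Z_N * F) := [set A : {set 'Z_N} | (p.1 \notin S) && ((#|A| == m) &&
      (0 <= \sum_(w in A)
         (defect (trig_sum (net p.2) (fun j => u j - p.1) w) + 3 * eta) * c p.1))].
have subB : [set Om : {set 'Z_N} | (#|Om| == m) && `[< unseparated S Om >]]
    \subset \bigcup_p B p.
  apply/subsetP => A; rewrite inE => /andP[mA /asboolP[t [tS [b [b1 h]]]]].
  have [k bk] := netP b1; apply/bigcupP; exists (t, k) => //.
  rewrite inE /= tS mA /= -mulr_suml pmulr_lge0//; apply: (le_trans h).
  have injd : injective (fun j => u j - t) by move=> i j /addIr/inju.
  apply: ler_sum => w _.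
  (* Moving from [b] to its net point costs at most [3 eta] per sample. *)
  have hL := defect_lipschitz (unit_trig_sum_le1 s0 (fun j => u j - t) b1 w)
    (unit_trig_sum_le1 s0 (fun j => u j - t) (net1 k) w).
  apply: (le_trans hL).
  rewrite lerD2l ler_pM2l//; apply: le_trans bk.
  apply: le_trans (normc_trig_sum_le _ (fun j => u j - t) w).
  rewrite /trig_sum -sumrB le_eqVlt; apply/orP; left; apply/eqP; congr normc.
  by apply: eq_bigr => j _; rewrite [RHS]mulrBl.
pose r t : R :=
  if generic t then (3 * s + 2)%:R^-1 else (4 * (3 * s + 2)%:R)^-1.
have cardB p : #|B p|%:R * m`!%:R <= N%:R ^+ m * expR (- r p.1 * m%:R).
  case: p => t k; rewrite /B /=; have [tS|tS] := boolP (t \in S).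
    rewrite (_ : [set A | _] = set0); last by apply/setP => A; rewrite !inE.
    by rewrite cards0 mul0r mulr_ge0 ?expR_ge0// exprn_ge0.
  have injd : injective (fun j => u j - t) by move=> i j /addIr/inju.
  have d0 j : u j - t != 0.
    by rewrite subr_eq0; apply: contraNneq tS => <-; exact: uS.
  rewrite /c /r; case: ifP => [/andP[g2 g3]|_].
  - apply: (@chernoff_defect _ _ _ _ _ (3 * s%:R)^-1) => //.
    + by apply/andP; split; lra.
    + exact: margin_generic.
    + apply: sum_expR_defect_generic => //.
        by move=> i j; move/forallP/(_ i)/forallP/(_ j): g2.
      by move=> i j l; move/forallP/(_ i)/forallP/(_ j)/forallP/(_ l): g3.
  - apply: (@chernoff_defect _ _ _ _ _ (8 * s%:R)^-1) => //.
    + by apply/andP; split; lra.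
    + exact: margin_any.
    + exact: sum_expR_defect_any.
apply: (@le_trans _ _ (\sum_(p : 'Z_N * F) #|B p|%:R * m`!%:R)).
  rewrite -mulr_suml ler_wpM2r// -natr_sum ler_nat.
  exact: leq_trans (subset_leq_card subB) (leq_card_bigcup _).
apply: (le_trans (ler_sum _ (fun p _ => cardB p))).
rewrite -mulr_sumr -[leRHS]mulrA [leRHS]mulrCA ler_wpM2l ?exprn_ge0//.
rewrite -(pair_bigA _ (fun t (k : F) => expR (- r t * m%:R))) /=.
under eq_bigr do rewrite sumr_const -[_ *+ _]mulr_natl.
rewrite -mulr_sumr ler_wpM2l// (bigID generic) /=.
apply: lerD.
  under eq_bigr => t gt do rewrite /r gt.
  rewrite sumr_const -[leLHS]mulr_natl ler_wpM2r ?expR_ge0// ler_nat.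
  by apply: leq_trans (max_card _) _; rewrite card_ord Zp_cast.
under eq_bigr => t /negbTE gt do rewrite /r gt.
rewrite sumr_const -[leLHS]mulr_natl ler_wpM2r ?expR_ge0// ler_nat.
apply: leq_trans card_not_generic; rewrite leq_eqVlt; apply/orP; left.
by apply/eqP; apply: eq_card => t; rewrite inE.
Qed.

End UnionBound.

(** * Sample size and sampling without replacement *)

Section SampleSize.
Variables (R : realType) (s : nat) (C : R).
Hypothesis C0 : 0 <= C.

Let sample_arg_ge0 N : (0 < N)%N -> 0 <= (3 * s + 2)%N%:R * C * ln (N%:R : R).
Proof. by move=> N0; rewrite mulr_ge0 ?ln_ge0 ?mulr_ge0// ler1n. Qed.

Lemma sample_size_ge N : (0 < N)%N ->
  (3 * s + 2)%:R * C * ln (N%:R : R) <= (sample_size s C N)%:R.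
Proof.
move=> N0; rewrite /sample_size natr_absz ger0_norm ?ceil_ge//.
by rewrite -(ler_int R); apply: le_trans (ceil_ge _); exact: sample_arg_ge0.
Qed.

Lemma sample_size_le N : (0 < N)%N ->
  (sample_size s C N)%:R <= (3 * s + 2)%:R * C * ln (N%:R : R) + 1.
Proof.
move=> N0; rewrite /sample_size natr_absz ger0_norm; last first.
  by rewrite -(ler_int R); apply: le_trans (ceil_ge _); exact: sample_arg_ge0.
rewrite -lerBlDr; apply: ltW.
have := ceil_itv ((3 * s + 2)%N%:R * C * ln (N%:R : R)).
by move=> /andP[+ _]; rewrite intrD mulrN1z.
Qed.

(** With [x = N^(1/4)], [log N <= 4x] gives a sample size at most [(4D + 1) x], whose square is of
    order [sqrt N]. The threshold [B] is the square of [2 (4D + 1)^2]. *)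
Lemma sample_size_sqr_eventually :
  exists N0, forall N, (N0 <= N)%N -> (2 * sample_size s C N ^ 2 <= N)%N.
Proof.
pose D : R := (3 * s + 2)%:R * C.
have D0 : 0 <= D by rewrite mulr_ge0.
pose B := 4 * (4 * D + 1) ^+ 4.
have B0 : 0 <= B by rewrite mulr_ge0// exprn_ge0//; lra.
exists (Num.truncn B).+1 => N BN.
have N0 : (0 < N)%N by apply: leq_trans BN.
have {}BN : B <= N%:R.
  have /andP[_ /ltW h] := truncn_itv B0; apply: le_trans h _.
  by rewrite ler_nat.
have NR : 1 <= N%:R :> R by rewrite ler1n.
pose y : R := Num.sqrt N%:R; pose x := Num.sqrt y.
have y0 : 0 <= y by exact: sqrtr_ge0.
have y2 : y ^+ 2 = N%:R by rewrite sqr_sqrtr.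
have x2 : x ^+ 2 = y by rewrite sqr_sqrtr.
have y1 : 1 <= y by rewrite -sqrtr1 ler_wsqrtr.
have x1 : 1 <= x by rewrite -sqrtr1 ler_wsqrtr.
have x0 : 0 < x by apply: lt_le_trans x1.
have lnN : ln (N%:R : R) <= 4 * x.
  have -> : (N%:R : R) = x ^+ 4 by rewrite -y2 -x2 -exprM.
  rewrite lnXn// -[leLHS]mulr_natl ler_pM2l//; apply: ltW; exact: ln_sublinear.
have mx : (sample_size s C N)%:R <= (4 * D + 1) * x.
  apply: (le_trans (sample_size_le N0)).
  have : D * ln (N%:R : R) <= D * (4 * x) by rewrite ler_wpM2l.
  rewrite /D; lra.
have Dy : 2 * (4 * D + 1) ^+ 2 <= y.
  rewrite -(ler_pXn2r (n := 2)) ?nnegrE//; last first.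
    by rewrite mulr_ge0// sqr_ge0.
  by rewrite y2 exprMn -exprM; apply: le_trans BN; rewrite /B; lra.
rewrite -(ler_nat R) natrM natrX -y2.
apply: (@le_trans _ _ (2 * ((4 * D + 1) * x) ^+ 2)).
  by rewrite ler_pM2l// lerXn2r ?nnegrE// (le_trans _ mx).
by rewrite exprMn x2 mulrA [leRHS]expr2 ler_wpM2r.
Qed.

End SampleSize.

(** The factor 2 comes from [|T|^m <= 2 m! binomial(|T|, m)], valid once [2m^2 <= |T|]. *)
Lemma unif_subset_prob_ge (R : realType) (T : finType) m (P bad : {set T} -> Prop)
    (e : R) : (2 * m ^ 2 <= #|T|)%N -> (forall A, ~ bad A -> P A) ->
  #|[set A : {set T} | (#|A| == m) && `[< bad A >]]|%:R * m`!%:R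
    <= #|T|%:R ^+ m * e ->
  1 - 2 * e <= unif_subset_prob R m P.
Proof.
move=> mT badP hbad; rewrite /unif_subset_prob.
set all := [set A : {set T} | #|A| == m].
set B := [set A | _ && `[< bad _ >]] in hbad; set G := [set A | _].
have mT' : (m <= #|T|)%N by rewrite -mulnn in mT; nia.
have cardall : #|all| = 'C(#|T|, m) by rewrite card_draws.
have all0 : 0 < #|all|%:R :> R by rewrite ltr0n cardall bin_gt0.
have allGB : (#|all| <= #|G| + #|B|)%N.
  apply: leq_trans (leq_card_setU G B); apply/subset_leq_card/subsetP => A.
  rewrite !inE => -> /=; case: (boolP `[< bad A >]) => [|/asboolPn nb].
    by rewrite orbT.
  by rewrite orbF; apply/asboolP; exact: badP.
have fact0 : 0 < m`!%:R :> R by rewrite ltr0n fact_gt0.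
have allm : #|T|%:R ^+ m <= 2 * (#|all|%:R * m`!%:R) :> R.
  rewrite cardall -natrM bin_ffact -natrX -natrM ler_nat.
  exact: leq_expn_ffact.
have e0 : 0 <= e.
  have Tm0 : 0 < #|T|%:R ^+ m :> R by rewrite -natrX ltr0n expn_gt0; lia.
  by rewrite -(pmulr_rge0 _ Tm0); apply: le_trans hbad; rewrite mulr_ge0.
have hB : #|B|%:R <= 2 * e * #|all|%:R.
  rewrite -(ler_pM2r fact0); apply: (le_trans hbad).
  rewrite [leRHS](_ : _ = 2 * (#|all|%:R * m`!%:R) * e); last by ring.
  by rewrite ler_wpM2r.
rewrite ler_pdivlMr// mulrBl mul1r.
have : #|all|%:R <= #|G|%:R + #|B|%:R :> R by rewrite -natrD ler_nat.
lra.
Qed.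

(** * Constants and exponents of the recovery probability *)

Theorem mainTheorem7 (R : realType) (s : nat) (C delta : R) :
  (1 <= s)%N -> 1 < C -> delta < (C - 1) ^+ 2 / (4 * C) ->
  exists A : R, exists N0 : nat, forall N : nat, (N0 <= N)%N ->
    forall S : {set 'Z_N}, #|S| = s ->
      1 - A * (N%:R `^ (- delta)) <=
      unif_subset_prob R (sample_size s C N)
        (fun Om : {set 'Z_N} =>
           forall x : {ffun 'Z_N -> R[i]},
             carried_by S x -> property_i Om x).
Proof.
move=> s0 C1 hdelta.
have sR : 0 < s%:R :> R by rewrite ltr0n.
have eps0 : 0 < (100 * s%:R ^+ 2)^-1 :> R.
  by rewrite invr_gt0 mulr_gt0// exprn_gt0.
have [F [net [net1 netP]]] := unit_coeffs_net s0 eps0.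
have [N1 hN1] := @sample_size_sqr_eventually R s C (ltW (lt_trans ltr01 C1)).
pose L : R := (2 * s ^ 2 + s ^ 3)%:R.
(* The 2 pays for sampling without replacement, [#|F|] for the net, 1 for the generic points and [L]
   for the exceptional ones. The threshold also gives [N > 1] and [N > s], so that [S] has a
   nonempty complement. *)
exists (2 * (#|F|%:R * (1 + L))), (N1 + s + 2)%N => N NN S cS.
have N_gt1 : (1 < N)%N by lia.
have N_gt0 : (0 < N)%N by lia.
have cT : #|{: 'Z_N}| = N by rewrite card_ord Zp_cast.
pose u (j : 'I_s) : 'Z_N := enum_val (cast_ord (esym cS) j).
have inju : injective u by move=> i j /enum_val_inj/cast_ord_inj.
have uS j : u j \in S by exact: enum_valP.
have SE : S = u @: setT.
  apply/esym/eqP; rewrite eqEcard; apply/andP; split.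
    by apply/subsetP => _ /imsetP[j _ ->].
  by rewrite card_imset// cardsT card_ord cS.
have SN : exists t, t \notin S.
  apply/existsP; rewrite -negb_forall; apply/negP => /forallP h.
  have /eq_card : S =i {: 'Z_N} by move=> t; rewrite h.
  by rewrite cT cS; lia.
rewrite -mulrA; apply: (unif_subset_prob_ge (bad := unseparated R u S)).
- by rewrite cT; apply: hN1; lia.
- move=> Om nbad x xS.
  apply: (property_i_of_separated N_gt1 s0 inju SE SN _ xS).
  move=> t tS b b1; rewrite ltNge; apply/negP => h.
  by apply: nbad; exists t; split => //; exists b.
apply: (le_trans (card_unseparated N_gt1 s0 inju net1 netP _ uS)).
rewrite cT -[leLHS]mulrA [leLHS]mulrCA ler_wpM2l ?exprn_ge0//.
rewrite -[leRHS]mulrA ler_wpM2l// [leRHS]mulrDl [1 * _]mul1r.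
have lnN : 0 <= ln (N%:R : R) by rewrite ln_ge0// ler1n.
have NE : (N%:R : R) = expR (ln N%:R) by rewrite lnK// posrE ltr0n.
have powE : N%:R `^ (- delta) = expR (- delta * ln N%:R).
  by rewrite /powR pnatr_eq0 gtn_eqF.
have := sample_size_ge s (ltW (lt_trans ltr01 C1)) N_gt0.
set m := (sample_size s C N)%:R; set l := ln (N%:R : R) in lnN NE powE *.
move=> hm; have q0 : 0 < (3 * s + 2)%:R :> R by rewrite ltr0n; lia.
have hq : C * l <= (3 * s + 2)%:R^-1 * m.
  by rewrite -(ler_pM2l q0) mulrA [leRHS]mulrA mulfV ?gt_eqF// mul1r.
(* The failure terms are of order [N^(1-C)] and [N^(-C/4)]; for [C > 1] both [C - 1] and [C/4]
   exceed [(C-1)^2/(4C)]. *)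
have C4 : 0 < 4 * C by lra.
have d1 : delta <= C - 1.
  apply: (le_trans (ltW hdelta)); rewrite ler_pdivrMr//; nra.
have d2 : delta <= C / 4.
  apply: (le_trans (ltW hdelta)); rewrite ler_pdivrMr//; nra.
apply: lerD.
  rewrite [X in X * _]NE powE -expRD ler_expR mulNr.
  have : delta * l <= (C - 1) * l by rewrite ler_wpM2r.
  lra.
rewrite ler_wpM2l// powE ler_expR invfM !mulNr lerN2 -mulrA.
have : delta * l <= C / 4 * l by rewrite ler_wpM2r.
lra.
Qed.
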